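(* For every $l$ there exists a constant $c = c(l)$ such that the following holds. If $F$ is an $l$-uniform $l$-partite hypergraph with $n$ vertices and maximum degree $\Delta$, $\epsilon > 0$, and $G$ is an $l$-uniform $l$-partite hypergraph with all parts of size $N \ge (\epsilon/2)^{-c\Delta^{l-1}} n$ and at least $\epsilon N^l$ edges, then $G$ contains a copy of $F$.
   Context: A hypergraph is $l$-uniform if every edge has exactly $l$ vertices. An $l$-uniform hypergraph is $l$-partite if its vertex set can be partitioned into $l$ parts such that each edge has exactly one vertex in each part. The degree of a vertex is the number of edges containing it, and the maximum degree is the largest degree of a vertex. A copy of $F$ in $G$ is a not necessarily induced subhypergraph of $G$ isomorphic to $F$. *)

(* Defs.v *)
From HB Require Import structures.
From mathcomp Require Import all_boot all_order all_algebra.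
From mathcomp Require Import reals exp.

Set Implicit Arguments.
Unset Strict Implicit.
Unset Printing Implicit Defensive.

(* A hypergraph on the finite vertex set [V] is its set of edges; every
   element of [V] is a vertex, isolated vertices included. *)
Definition hypergraph (V : finType) := {set {set V}}.

Section Hypergraph.

Variable V : finType.
Implicit Types (H G : hypergraph V) (S e : {set V}) (v : V).

Definition uniform (l : nat) H : Prop := forall e, e \in H -> #|e| = l.

(* Parts may be empty, hence not [finset.partition]. *)
Definition partite_by (l : nat) H (P : 'I_l -> {set V}) : Prop :=
  [/\ \bigcup_i P i = [set: V],
      forall i j, i != j -> [disjoint P i & P j]
    & forall e, e \in H -> forall i, #|e :&: P i| = 1%N].

Definition partite (l : nat) H : Prop :=
  exists P : 'I_l -> {set V}, partite_by H P.

Definition degree H v : nat := #|[set e in H | v \in e]|.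

Definition max_degree H : nat := \max_(v : V) degree H v.

(* [H], with vertex set [S], is a (not necessarily induced) subhypergraph
   of [G]. *)
Definition subhypergraph S H G : Prop :=
  H \subset G /\ (forall e, e \in H -> e \subset S).

End Hypergraph.

(* [f] is an isomorphism from [F] onto the hypergraph with vertex set [S]
   and edge set [H]. *)
Definition isomorphism (V W : finType) (F : hypergraph V)
    (S : {set W}) (H : hypergraph W) (f : V -> W) : Prop :=
  [/\ injective f, f @: [set: V] = S & [set f @: e | e : {set V} in F] = H].

Definition contains_copy (V W : finType) (F : hypergraph V)
    (G : hypergraph W) : Prop :=
  exists (S : {set W}) (H : hypergraph W),
    subhypergraph S H G /\ exists f : V -> W, isomorphism F S H f.

(* Main.v *)
Require Import Defs.
From HB Require Import structures.
From mathcomp Require Import all_boot all_order all_algebra.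
From mathcomp Require Import reals exp.
From mathcomp Require Import ring lra zify.

Set Implicit Arguments.
Unset Strict Implicit.
Unset Printing Implicit Defensive.

Import Order.TTheory GRing.Theory Num.Theory.
Local Open Scope ring_scope.

(* Dependent random choice, iterated over the parts.  Identify all parts of G
   with a set U of size N, so that G becomes a set H_l of points of U^l.  For
   k = l-1, ..., 0 pick t = O(Delta) random elements of U and let H_k be the
   points that stay in H_(k+1) whatever chosen element replaces coordinate k.
   By convexity the density e of H_(k+1) becomes at least e^t on average,
   while a set of H_k-edges whose common neighbourhood in part k has fewer
   than delta N elements survives with probability at most delta^t.  With
   delta the square of the smallest density met, the proportion beta of
   Delta x l arrays of vertices containing such a bad set is tiny at each level.

   F is then embedded vertex by vertex, lower parts first.  For each vertex u
   not yet embedded, keep track of the proportion of arrays that are bad once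
   the embedded neighbours of u are written into them.  When v is embedded, at
   most Delta l of these proportions change, and by Markov's inequality v can
   be placed, among the at least delta N candidates, so that each of them grows
   by a factor at most gamma = 2 (Delta l + 1) / delta.  As
   beta gamma^(Delta l) < 1, the proportion attached to u is still below 1 when
   u has to be embedded, hence u has at least delta N candidates in turn. *)

(** * Resampling one coordinate *)

Section Update.
Variables A U : finType.
Implicit Types (g : {ffun A -> U}) (a : A) (x : U).

Definition upd g a x : {ffun A -> U} := [ffun b => if b == a then x else g b].

(** Swapping [x] with the entry of [g] at [a] is an involution on pairs, so a resampled point is
    uniform again. *)
Lemma sum_upd (M : nmodType) (f : {ffun A -> U} -> M) a :
  \sum_x \sum_g f (upd g a x) = (\sum_g f g) *+ #|U|.
Proof.
rewrite pair_big /=.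
pose h (q : U * {ffun A -> U}) := (q.2 a, upd q.2 a q.1).
have hK : involutive h.
  move=> [x g]; rewrite /h /= ffunE eqxx; congr (_, _).
  by apply/ffunP => b; rewrite !ffunE; case: eqP => // ->.
have -> : \sum_(q : U * {ffun A -> U}) f (upd q.2 a q.1) = \sum_q f (h q).2 by [].
rewrite -(reindex h (P := predT) (F := fun q => f q.2)) /=; last first.
  exact: onW_bij (inv_bij hK).
by rewrite -(pair_big predT predT (fun _ g => f g)) /= sumr_const.
Qed.

End Update.

(** * Averaging *)

Section RealLemmas.
Variable R : realFieldType.

Lemma natr_card (I : finType) (A : {pred I}) :
  #|A|%:R = \sum_i (i \in A)%:R :> R.
Proof.
rewrite -sum1_card natr_sum big_mkcond; apply: eq_bigr => i _.
by case: (i \in A).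
Qed.

(** By induction: multiplying one bound by [x] exceeds the next one by a nonnegative multiple of
    [(x - y) ^+ 2]. *)
Lemma expr_tangent (x y : R) n : 0 <= x -> 0 <= y ->
  y ^+ n.+1 + n.+1%:R * y ^+ n * (x - y) <= x ^+ n.+1.
Proof.
move=> x0 y0; elim: n => [|n IH]; first by rewrite !expr1 expr0; lra.
have := ler_wpM2l x0 IH; rewrite -exprS; apply: le_trans.
have h : 0 <= n.+1%:R * y ^+ n * (x - y) ^+ 2.
  by rewrite mulr_ge0 ?sqr_ge0 // mulr_ge0 ?exprn_ge0.
rewrite -subr_ge0; congr (0 <= _): h.
by rewrite -[n.+2%:R]natr1 !exprS; ring.
Qed.

Lemma power_mean (I : finType) (f : I -> R) (m : R) n :
  (forall i, 0 <= f i) -> 0 <= m -> #|I|%:R * m <= \sum_i f i ->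
  #|I|%:R * m ^+ n <= \sum_i f i ^+ n.
Proof.
move=> f0 m0 hm; case: n => [|n].
  by rewrite expr0 mulr1 (eq_bigr (fun=> 1)) // sumr_const.
apply: (@le_trans _ _ (\sum_i (m ^+ n.+1 + n.+1%:R * m ^+ n * (f i - m)))); last first.
  by apply: ler_sum => i _; apply: expr_tangent.
rewrite big_split /= sumr_const -mulr_sumr sumrB sumr_const.
rewrite -(mulr_natl (m ^+ n.+1)) -(mulr_natl m) lerDl mulr_ge0 ?subr_ge0 //.
by rewrite mulr_ge0 ?exprn_ge0.
Qed.

Lemma exists_dense_sparse (I : finType) (f g : I -> R) (a b : R) :
  (0 < #|I|)%N -> 0 < a -> 0 < b -> (forall i, f i <= 1) ->
  (forall i, 0 <= g i) ->
  #|I|%:R * a <= \sum_i f i -> \sum_i g i <= #|I|%:R * b ->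
  exists i, a / 2 <= f i /\ g i <= 2 * b / a.
Proof.
move=> I0 a0 b0 f1 g0 hf hg.
case: (pickP (fun i => (a / 2 <= f i) && (g i <= 2 * b / a))) => [i /andP[] |no].
  by exists i.
have /card_gt0P[i0 _] := I0.
(* If every [i] failed, this would hold throughout: for large [g i] the last term alone exceeds 1.
   Summing contradicts the two averages. *)
have fg i : f i < a / 2 + a / (2 * b) * g i.
  have c0 : 0 < a / (2 * b) by rewrite divr_gt0 ?mulr_gt0.
  move/negbT: (no i); rewrite negb_and -!ltNge => /orP[h|h].
    by apply: (lt_le_trans h); rewrite lerDl mulr_ge0 // ltW.
  have : a / (2 * b) * (2 * b / a) < a / (2 * b) * g i by rewrite ltr_pM2l.
  have -> : a / (2 * b) * (2 * b / a) = 1 by field; lra.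
  by have := f1 i; lra.
have : \sum_i f i < \sum_i (a / 2 + a / (2 * b) * g i).
  by apply: ltr_sum => //; apply/hasP; exists i0; rewrite ?mem_index_enum.
rewrite big_split /= sumr_const -mulr_sumr -(mulr_natl (a / 2)).
have : a / (2 * b) * \sum_i g i <= a / (2 * b) * (#|I|%:R * b).
  by rewrite ler_pM2l ?divr_gt0 ?mulr_gt0.
have -> : a / (2 * b) * (#|I|%:R * b) = #|I|%:R * a / 2 by field; lra.
rewrite !mulrA => h1 h2; exfalso; move: hf h1 h2; lra.
Qed.

End RealLemmas.

(** * Iterated dependent random choice *)

Section Chain.
Variables (R : realFieldType) (U : finType) (l d t : nat).
Hypothesis U0 : (0 < #|U|)%N.

Local Notation N := (#|U|%:R : R).
Local Notation point := {ffun 'I_l -> U}.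
Local Notation array := {ffun 'I_d * 'I_l -> U}.
Local Notation selection := {ffun 'I_l -> 'I_d}.
Implicit Types (H K : {set point}) (X : array).

(* A selection picks one entry per coordinate of an array; a set of selections
   thus describes an l-partite hypergraph on the entries of any array. *)
Definition row_of X (s : selection) : point := [ffun i => X (s i, i)].

Definition common (k : 'I_l) K X (S : {set selection}) : {set U} :=
  [set x | [forall s in S, upd (row_of X s) k x \in K]].

Definition bad (theta : R) (k : 'I_l) H K : {set array} :=
  [set X | [exists S : {set selection}, [forall s in S, row_of X s \in H]
                      && (#|common k K X S|%:R < theta)]].

Definition slice (k : 'I_l) K (T : {ffun 'I_t -> U}) : {set point} :=
  [set g | [forall j, upd g k (T j) \in K]].

(* H depends only on the coordinates below k: it encodes a k-partite k-uniform
   hypergraph on the first k parts. *)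
Definition lower (k : nat) H :=
  forall g h : point, (forall i : 'I_l, (i < k)%N -> g i = h i) ->
    (g \in H) = (h \in H).

(** * Average density and average number of bad arrays of a slice *)

Lemma card_tuples_in (A : {set U}) :
  #|[set T : {ffun 'I_t -> U} | [forall j, T j \in A]]| = (#|A| ^ t)%N.
Proof.
rewrite -[t in RHS]card_ord -card_ffun_on cardsE; apply: eq_card => T.
by rewrite unfold_in; apply: eq_forallb.
Qed.

Lemma Npos : 0 < N. Proof. by rewrite ltr0n. Qed.

(** A point [g] survives iff all [t] chosen elements lie among its [f g] good replacements, hence
    for [f g ^+ t] choices; convexity does the rest. *)
Lemma sum_slice (k : 'I_l) K (e : R) : 0 <= e -> e * N ^+ l <= #|K|%:R ->
  N ^+ t * e ^+ t <= \sum_T #|slice k K T|%:R / N ^+ l.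
Proof.
move=> e0 hK.
pose f g : R := #|[set x | upd g k x \in K]|%:R.
have cardP : #|{: point}|%:R = N ^+ l by rewrite card_ffun card_ord natrX.
have sumf : \sum_g f g = N * #|K|%:R.
  rewrite (eq_bigr (fun g => \sum_x (upd g k x \in K)%:R)); last first.
    by move=> g _; rewrite /f natr_card; apply: eq_bigr => x _; rewrite inE.
  rewrite exchange_big /= (sum_upd (fun g => (g \in K)%:R) k) -[LHS]mulr_natl.
  by rewrite -natr_card.
have hpm : N ^+ l * (e * N) ^+ t <= \sum_g f g ^+ t.
  rewrite -cardP; apply: power_mean => //; first by rewrite mulr_ge0 ?ler0n.
  by rewrite sumf cardP; have := ler_wpM2l (ltW Npos) hK; congr (_ <= _); ring.
have -> : \sum_T #|slice k K T|%:R / N ^+ l = (\sum_g f g ^+ t) / N ^+ l.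
  rewrite -mulr_suml; congr (_ / _).
  under eq_bigr => T _ do rewrite natr_card.
  rewrite exchange_big; apply: eq_bigr => g _ /=.
  rewrite -natrX -card_tuples_in natr_card; apply: eq_bigr => T _.
  by rewrite !inE; congr (nat_of_bool _)%:R; apply: eq_forallb => j; rewrite inE.
rewrite ler_pdivlMr ?exprn_gt0 ?Npos //; apply: le_trans hpm.
by rewrite exprMn mulrC [e ^+ t * _]mulrC.
Qed.


(** For a fixed array, all rows of [S] survive iff every chosen element lies in their common
    neighbourhood. The factor [2 ^ (d ^ l)] is a union bound over [S]. *)
Lemma sum_bad (delta : R) (k : 'I_l) K : 0 <= delta ->
  \sum_T #|bad (delta * N) k (slice k K T) K|%:R / N ^+ (d * l)
    <= N ^+ t * ((2 ^ (d ^ l))%:R * delta ^+ t).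
Proof.
move=> d0.
have cardX : #|{: array}|%:R = N ^+ (d * l) by rewrite card_ffun card_prod !card_ord natrX.
have cardS : #|{: {set selection}}| = (2 ^ (d ^ l))%N.
  by rewrite -cardsT -powersetT card_powerset cardsT card_ffun !card_ord.
rewrite -mulr_suml ler_pdivrMr ?exprn_gt0 ?Npos //.
pose rows_in X (S : {set selection}) T := [forall s in S, row_of X s \in slice k K T].
have rowsP X S T : rows_in X S T = [forall j, T j \in common k K X S].
  apply/idP/forallP => [/forall_inP h j|h].
    by rewrite inE; apply/forall_inP => s /h; rewrite inE => /forallP.
  apply/forall_inP => s sS; rewrite inE; apply/forallP => j.
  by have := h j; rewrite inE => /forall_inP; apply.
apply: (@le_trans _ _ (\sum_T \sum_X \sum_S
    (rows_in X S T && (#|common k K X S|%:R < delta * N))%:R)).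
  apply: ler_sum => T _; rewrite natr_card; apply: ler_sum => X _; rewrite inE.
  case: existsP => [[S hS]|_]; last by rewrite sumr_ge0.
  by rewrite (bigD1 S) //= -/(rows_in X S T) hS lerDl sumr_ge0.
rewrite exchange_big /= -cardX -cardS.
apply: (@le_trans _ _ (\sum_(X : array) \sum_(S : {set selection}) (delta * N) ^+ t)).
  apply: ler_sum => X _; rewrite exchange_big /=; apply: ler_sum => S _.
  case: ltP => hS; last first.
    by rewrite big1 ?exprn_ge0 ?mulr_ge0 // => T _; rewrite andbF.
  apply: (@le_trans _ _ (#|common k K X S|%:R ^+ t)); last first.
    by rewrite lerXn2r ?nnegrE ?mulr_ge0 // ltW.
  rewrite -natrX -card_tuples_in natr_card; apply: ler_sum => T _.
  by rewrite andbT rowsP inE.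
rewrite !sumr_const -[leLHS]mulr_natr -[_ ^+ t *+ _]mulr_natr exprMn.
by rewrite le_eqVlt; apply/orP; left; apply/eqP; ring.
Qed.

Lemma exists_slice (delta e : R) (k : 'I_l) K : 0 < delta -> 0 < e ->
  e * N ^+ l <= #|K|%:R ->
  exists H, [/\ e ^+ t / 2 * N ^+ l <= #|H|%:R,
    #|bad (delta * N) k H K|%:R
      <= 2 * ((2 ^ (d ^ l))%:R * delta ^+ t) / e ^+ t * N ^+ (d * l)
    & lower k.+1 K -> lower k H].
Proof.
move=> d0 e0 hK.
have cardT : #|{: {ffun 'I_t -> U}}|%:R = N ^+ t by rewrite card_ffun card_ord natrX.
have [|||||||T [h1 h2]] := @exists_dense_sparse R {ffun 'I_t -> U}
  (fun T => #|slice k K T|%:R / N ^+ l)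
  (fun T => #|bad (delta * N) k (slice k K T) K|%:R / N ^+ (d * l))
  (e ^+ t) ((2 ^ (d ^ l))%:R * delta ^+ t).
- by rewrite card_ffun card_ord expn_gt0 U0.
- exact: exprn_gt0.
- by rewrite mulr_gt0 ?exprn_gt0 // ltr0n expn_gt0.
- move=> T; rewrite ler_pdivrMr ?exprn_gt0 ?Npos // mul1r -natrX ler_nat.
  by rewrite -[l in X in (_ <= X)%N]card_ord -card_ffun max_card.
- by move=> T; rewrite divr_ge0 ?exprn_ge0.
- by rewrite cardT; apply: sum_slice hK; apply: ltW.
- by rewrite cardT; apply: sum_bad; apply: ltW.
exists (slice k K T); split.
- by rewrite -ler_pdivlMr ?exprn_gt0 ?Npos.
- by rewrite -ler_pdivrMr ?exprn_gt0 ?Npos.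
move=> lK g h gh; rewrite !inE; apply: eq_forallb => j; apply: lK => i.
by rewrite ltnS !ffunE; case: eqP => // ik; rewrite leq_eqVlt => /orP[/eqP/val_inj //|/gh].
Qed.

Lemma exists_chain (a beta delta : R) (K : {set point}) :
  0 < a -> a <= 2^-1 -> (0 < t)%N -> 0 < delta -> 0 <= beta ->
  (2 * a) * N ^+ l <= #|K|%:R ->
  2 * ((2 ^ (d ^ l))%:R * delta ^+ t) <= beta * (a ^+ ((2 * t) ^ l.-1)) ^+ t ->
  exists H : nat -> {set point}, [/\ H l = K, H 0%N = setT,
      forall k, (k <= l)%N -> lower k (H k)
    & forall k : 'I_l,
        #|bad (delta * N) k (H k) (H k.+1)|%:R <= beta * N ^+ (d * l)].
Proof.
move=> a0 a2 t0 d0 beta0 hK hbeta.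
have a1 : a <= 1 by apply: le_trans a2 _; rewrite invf_le1 ?ler1n.
suff chain m : (m <= l)%N -> exists H : nat -> {set point}, [/\ H l = K,
    a ^+ ((2 * t) ^ m) * N ^+ l <= #|H (l - m)%N|%:R,
    forall k, (l - m <= k <= l)%N -> lower k (H k)
  & forall k : 'I_l, (l - m <= k)%N ->
      #|bad (delta * N) k (H k) (H k.+1)|%:R <= beta * N ^+ (d * l)].
  have [H [Hl H0 Hlow Hbad]] := chain l (leqnn l).
  exists H; split => // [|k kl|k]; last 1 first.
  - by apply: Hbad; rewrite subnn.
  (* [H 0] depends on no coordinate, so a single point in it makes it everything. *)
  - have [g gH] : exists g, g \in H 0%N.
      apply/set0Pn; apply: contraTneq H0 => H0; rewrite subnn H0 cards0 -ltNge.
      by rewrite mulr_gt0 ?exprn_gt0 ?Npos.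
    apply/setP => h; rewrite inE -(Hlow 0%N _ g) ?subnn //.
  - by apply: Hlow; rewrite subnn.
elim: m => [_|m IH ml].
  exists (fun=> K); rewrite subn0; split => // [|k|k].
  - rewrite expn0 expr1; apply: le_trans hK.
    by rewrite ler_wpM2r ?exprn_ge0 //; lra.
  - rewrite -eqn_leq => /eqP <- g h gh.
    by have -> : g = h by apply/ffunP => i; apply: gh.
  - by rewrite leqNgt ltn_ord.
have [H [Hl Hden Hlow Hbad]] := IH (ltnW ml).
have kl : (l - m.+1 < l)%N by rewrite ltn_subrL (leq_trans _ ml).
pose k := Ordinal kl.
have kS : k.+1 = (l - m)%N by rewrite /= subnSK.
have [L [Lden Lbad Llow]] :=
  exists_slice k d0 (exprn_gt0 ((2 * t) ^ m) a0) Hden.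
exists (fun j => if j == k :> nat then L else H j); split.
- by rewrite gtn_eqF.
- rewrite eqxx; apply: le_trans Lden; apply: ler_wpM2r; first exact: exprn_ge0.
  (* As [a] is at most one half, the lost factor 2 costs one more power of [a], which the 2 in the
     base [2 * t] absorbs. *)
  rewrite -exprM; apply: (@le_trans _ _ (a ^+ ((2 * t) ^ m * t + 1))).
    apply: ler_wiXn2l => //; first exact: ltW.
    rewrite expnSr mulnCA [leqRHS]mul2n -addnn leq_add2l.
    by rewrite muln_gt0 expn_gt0 muln_gt0 t0.
  by rewrite exprD expr1 ler_wpM2l ?exprn_ge0 // ltW.
- move=> j /andP[kj jl]; case: eqP => [->|/eqP jk].
    by apply: Llow; rewrite kS; apply: Hlow; rewrite leqnn leq_subr.
  by apply: Hlow; rewrite jl andbT -kS ltn_neqAle eq_sym jk.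
- move=> j kj; case: eqP => [/val_inj ->|/eqP jk]; last first.
    rewrite gtn_eqF ?ltnS //; apply: Hbad.
    by rewrite -kS ltn_neqAle eq_sym jk.
  rewrite gtn_eqF // kS; apply: (le_trans Lbad); apply: ler_wpM2r.
    exact: exprn_ge0.
  (* [hbeta] is stated for the smallest density that still gets sliced, reached after [l.-1]
     slices. *)
  rewrite ler_pdivrMr ?exprn_gt0 //; apply: le_trans hbeta _.
  rewrite ler_wpM2l // lerXn2r ?nnegrE ?exprn_ge0 ?(ltW a0) //.
  apply: ler_wiXn2l => //; first exact: ltW.
  by rewrite leq_pexp2l ?muln_gt0 // -ltnS prednK ?(leq_trans _ ml).
Qed.

End Chain.

(** * Greedy embedding *)

Section Embedding.
Variables (R : realFieldType) (U V : finType) (l d' : nat).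
Variables (p : V -> 'I_l) (F : {set {ffun 'I_l -> V}}).
Local Notation d := d'.+1.
Local Notation N := (#|U|%:R : R).
Local Notation point := {ffun 'I_l -> U}.
Local Notation array := {ffun 'I_d * 'I_l -> U}.
Implicit Types (u v : V) (D : {set V}) (phi : {ffun V -> U}) (Y : array).

(** An edge lists its vertices part by part, so it contains [u] iff its entry at part [p u] is
    [u]. *)
Definition link u := [set e in F | e (p u) == u].

Hypothesis F_part : forall e, e \in F -> forall i, p (e i) = i.
Hypothesis F_deg : forall v, (#|link v| <= d)%N.

Definition adjacent u v := [exists e in link u, e (p v) == v].

Lemma adjacent_sym u v : adjacent u v = adjacent v u.
Proof.
by apply/exists_inP/exists_inP => -[e]; rewrite inE => /andP[eF h1] h2;
  exists e => //; rewrite inE eF.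
Qed.

Lemma card_adjacent u : (#|[set v | adjacent u v]| <= d * l)%N.
Proof.
pose f (q : {ffun 'I_l -> V} * 'I_l) := q.1 q.2.
apply: (@leq_trans #|f @: setX (link u) [set: 'I_l]|).
  apply: subset_leq_card; apply/subsetP => v; rewrite inE => /exists_inP[e eu /eqP ev].
  by apply/imsetP; exists (e, p v); rewrite // in_setX eu inE.
apply: leq_trans (leq_imset_card _ _) _.
by rewrite cardsX cardsT card_ord leq_mul2r F_deg orbT.
Qed.

(* Embeds the neighbourhood of u into the cells of an array: within each part,
   v is sent to the index of an edge containing u and v. *)
Definition column u v : 'I_d :=
  if [pick e in link u | e (p v) == v] is Some e then inord (index e (enum (link u)))
  else ord0.

Definition cell u v := (column u v, p v).

(** A cell determines a part and an edge through [u], and an edge has one vertex in each part. *)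
Lemma cell_inj u v v' : adjacent u v -> adjacent u v' ->
  cell u v = cell u v' -> v = v'.
Proof.
have idx e : e \in link u -> (index e (enum (link u)) < d)%N.
  move=> eu; apply: leq_trans (F_deg u).
  by rewrite cardE index_mem mem_enum.
move=> /exists_inP[e0 e0u e0v] /exists_inP[e1 e1u e1v] [+ pv].
rewrite /column; case: pickP => [e /andP[eu /eqP ev]|/(_ e0)]; last by rewrite e0u e0v.
case: pickP => [e' /andP[eu' /eqP ev']|/(_ e1)]; last by rewrite e1u e1v.
move/(congr1 val); rewrite /= !inordK ?idx // => ii.
have ee : e = e'.
  by rewrite -(nth_index e (s := enum (link u)) (x := e)) ?mem_enum // ii nth_index ?mem_enum.
by rewrite -ev -ev' -ee pv.
Qed.

(** * Writing embedded neighbours into an array *)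

Definition overwrite u D phi Y : array :=
  [ffun c => if [pick v in D | adjacent u v && (cell u v == c)] is Some v
             then phi v else Y c].

Lemma overwrite_cell u D phi Y v : v \in D -> adjacent u v ->
  overwrite u D phi Y (cell u v) = phi v.
Proof.
move=> vD uv; rewrite ffunE; case: pickP => [w /and3P[_ uw /eqP h]|/(_ v)].
  by rewrite (cell_inj uw uv h).
by rewrite vD uv eqxx.
Qed.

Lemma overwrite0 u phi Y : overwrite u set0 phi Y = Y.
Proof.
by apply/ffunP => c; rewrite ffunE; case: pickP => // v; rewrite inE.
Qed.

(** Placing [v] at [x] amounts to resampling one cell of [Y]; this lets [sum_upd] average over
    [x]. *)
Lemma overwrite_adjacent u D phi Y v x : v \notin D -> adjacent u v ->
  overwrite u (v |: D) (upd phi v x) Y = overwrite u D phi (upd Y (cell u v) x).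
Proof.
move=> vD uv; apply/ffunP => c.
have [<-|cv] := eqVneq (cell u v) c.
  rewrite overwrite_cell ?setU11 // !ffunE eqxx.
  case: pickP => [w /and3P[wD uw /eqP h]|_]; last by rewrite ?ffunE ?eqxx.
  by move: vD; rewrite -(cell_inj uw uv h) wD.
rewrite !ffunE (eq_pick (Q := [pred w | (w \in D) && (adjacent u w && (cell u w == c))])).
  case: pickP => [w /andP[wD _]|_]; rewrite ?ffunE.
    by case: eqP => // wv; rewrite wv (negbTE vD) in wD.
  by rewrite eq_sym (negbTE cv).
by move=> w /=; rewrite !inE; case: eqP => // ->; rewrite (negbTE cv) !andbF.
Qed.

Lemma overwrite_nonadjacent u D phi Y v x : v \notin D -> ~~ adjacent u v ->
  overwrite u (v |: D) (upd phi v x) Y = overwrite u D phi Y.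
Proof.
move=> vD uv; apply/ffunP => c.
rewrite !ffunE (eq_pick (Q := [pred w | (w \in D) && (adjacent u w && (cell u w == c))])).
  case: pickP => [w /andP[wD _]|_] //; rewrite ?ffunE.
  by case: eqP => // wv; rewrite wv (negbTE vD) in wD.
by move=> w /=; rewrite !inE; case: eqP => // ->; rewrite (negbTE uv) !andbF.
Qed.

Variables (H : nat -> {set point}) (beta delta : R).
Hypothesis H0 : H 0%N = setT.
Hypothesis H_lower : forall k, (k <= l)%N -> lower k (H k).
Hypothesis beta_gt0 : 0 < beta.
Hypothesis delta_gt0 : 0 < delta.
Hypothesis delta_le1 : delta <= 1.
Hypothesis H_bad : forall k : 'I_l,
  #|bad d (delta * N) k (H k) (H k.+1)|%:R <= beta * N ^+ (d * l).
Let gamma := 2 * (d * l).+1%:R / delta.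
Hypothesis beta_gamma : beta * gamma ^+ (d * l) < 1.
Hypothesis U_large : 2 * #|V|%:R <= delta * N.
Hypothesis U_gt0 : (0 < #|U|)%N.

(** * Weights, their bounds and the embedding invariant *)

Definition weight u D phi :=
  #|[set Y | overwrite u D phi Y \in bad d (delta * N) (p u) (H (p u)) (H (p u).+1)]|.

Definition bound u D : R :=
  beta * gamma ^+ #|[set v in D | adjacent u v]| * N ^+ (d * l).

Definition edge_image phi (e : {ffun 'I_l -> V}) : point := [ffun i => phi (e i)].

(** Parts are filled in increasing order. Values of [phi] outside [D] are placeholders, harmless in
    the third clause since [H k] reads only the first [k] coordinates. *)
Definition invariant D phi :=
  [/\ forall v v', v \in D -> (p v' < p v)%N -> v' \in D,
      forall v v', v \in D -> v' \in D -> p v = p v' -> phi v = phi v' -> v = v',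
      forall e, e \in F -> forall k, (k <= l)%N ->
        (forall i : 'I_l, (i < k)%N -> e i \in D) -> edge_image phi e \in H k
    & forall u, u \notin D -> (weight u D phi)%:R <= bound u D].

Let gamma_ge1 : 1 <= gamma.
Proof.
rewrite ler_pdivlMr // mul1r (le_trans delta_le1) // -natrM ler1n.
by rewrite muln_gt0.
Qed.

Let gamma_gt0 : 0 < gamma. Proof. exact: lt_le_trans gamma_ge1. Qed.

Let N_gt0 : 0 < N. Proof. by rewrite ltr0n. Qed.

Lemma bound_gt0 u D : 0 < bound u D.
Proof. by rewrite !mulr_gt0 ?exprn_gt0. Qed.

Lemma bound_lt u D : bound u D < N ^+ (d * l).
Proof.
rewrite -[ltRHS]mul1r ltr_pM2r ?exprn_gt0 //; apply: le_lt_trans beta_gamma.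
rewrite ler_pM2l // ler_weXn2l //; apply: leq_trans (card_adjacent u).
by apply: subset_leq_card; apply/subsetP => v; rewrite !inE => /andP[].
Qed.

Lemma candidates D phi v : invariant D phi -> v \notin D ->
  (forall v', (p v' < p v)%N -> v' \in D) ->
  delta * N <= #|[set x | [forall e in link v,
                   upd (edge_image phi e) (p v) x \in H (p v).+1]]|%:R.
Proof.
move=> [_ _ hF hw] vD vmin.
set B := bad d (delta * N) (p v) (H (p v)) (H (p v).+1).
(* Otherwise the weight of [v] would count all arrays, against [bound_lt]. *)
have [Y hY] : exists Y, overwrite v D phi Y \notin B.
  apply/existsP; apply: contraLR (le_lt_trans (hw v vD) (bound_lt v D)).
  rewrite negb_exists => /forallP h; rewrite -leNgt /weight -/B.
  have -> : [set Y | overwrite v D phi Y \in B] = setT.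
    by apply/setP => Y; rewrite in_set in_setT; have := h Y; rewrite negbK.
  by rewrite cardsT card_ffun card_prod !card_ord natrX.
(* [X] is not bad; this is applied to the selections [sel e] of the edges through [v], whose rows
   agree with the embedded edges below [p v]. *)
rewrite {}/B in hY; set X := overwrite v D phi Y in hY.
pose sel (e : {ffun 'I_l -> V}) := [ffun i => column v (e i)].
have rowE e (i : 'I_l) : e \in link v -> (i < p v)%N ->
    row_of X (sel e) i = edge_image phi e i.
  move=> ev iv; have eF : e \in F by move: ev; rewrite inE => /andP[].
  have -> : row_of X (sel e) i = X (cell v (e i)).
    by rewrite ffunE [sel e i]ffunE /cell F_part.
  rewrite [RHS]ffunE; apply: overwrite_cell; first by apply: vmin; rewrite F_part.
  by apply/exists_inP; exists e; rewrite ?F_part.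
move: hY; rewrite inE negb_exists => /forallP/(_ (sel @: link v)).
rewrite negb_and -leNgt => /orP[/negP[]|].
  apply/forall_inP => _ /imsetP[e ev ->].
  rewrite (@H_lower (p v) _ _ (edge_image phi e)) ?(ltnW (ltn_ord _)) //.
    have eF : e \in F by move: ev; rewrite inE => /andP[].
    by apply: hF => // [|i iv]; [exact: ltnW (ltn_ord _)|apply: vmin; rewrite F_part].
  by move=> i; apply: rowE.
move/le_trans; apply; rewrite ler_nat; apply: subset_leq_card.
apply/subsetP => x; rewrite !inE => /forall_inP h; apply/forall_inP => e ev.
rewrite -(@H_lower (p v).+1 _ (upd (row_of X (sel e)) (p v) x)) //.
  by apply: h; apply: imset_f.
move=> i; rewrite ltnS leq_eqVlt => /orP[/eqP/val_inj ->|iv]; first by rewrite !ffunE eqxx.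
by rewrite [LHS]ffunE [RHS]ffunE; case: eqP => // _; apply: rowE.
Qed.

Lemma weight_adjacent u D phi v : v \notin D -> adjacent u v ->
  \sum_x (weight u (v |: D) (upd phi v x))%:R = N * (weight u D phi)%:R.
Proof.
move=> vD uv; set B := bad d (delta * N) (p u) (H (p u)) (H (p u).+1).
have cardE0 (P : pred array) : #|[set Y | P Y]|%:R = \sum_Y (P Y)%:R :> R.
  by rewrite natr_card; apply: eq_bigr => Y _; rewrite inE.
under eq_bigr => x _ do (rewrite /weight cardE0;
  under eq_bigr => Y _ do rewrite overwrite_adjacent //).
rewrite (sum_upd (fun Y => (overwrite u D phi Y \in B)%:R : R)).
by rewrite -cardE0 -[LHS]mulr_natl.
Qed.

Lemma weight_nonadjacent u D phi v x : v \notin D -> ~~ adjacent u v ->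
  weight u (v |: D) (upd phi v x) = weight u D phi.
Proof.
by move=> vD uv; rewrite /weight; apply: eq_card => Y; rewrite !inE overwrite_nonadjacent.
Qed.

Lemma bound_adjacent u D v : v \notin D -> adjacent u v ->
  bound u (v |: D) = gamma * bound u D.
Proof.
move=> vD uv; rewrite /bound.
have -> : [set w in v |: D | adjacent u w] = v |: [set w in D | adjacent u w].
  by apply/setP => w; rewrite !inE; case: eqP => // ->; rewrite uv.
by rewrite cardsU1 inE (negbTE vD) add1n exprS mulrCA -!mulrA.
Qed.

Lemma bound_nonadjacent u D v : ~~ adjacent u v ->
  bound u (v |: D) = bound u D.
Proof.
move=> uv; rewrite /bound.
have -> // : [set w in v |: D | adjacent u w] = [set w in D | adjacent u w].
by apply/setP => w; rewrite !inE; case: eqP => // ->; rewrite (negbTE uv) !andbF.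
Qed.

(** Markov's inequality: the average new weight over [x] is the old weight, while the bound grows by
    [gamma]. *)
Lemma card_overweight u D phi v : v \notin D -> u \notin D -> adjacent u v ->
  invariant D phi ->
  #|[set x | bound u (v |: D) < (weight u (v |: D) (upd phi v x))%:R]|%:R
    <= N / gamma.
Proof.
move=> vD uD uv [_ _ _ /(_ u uD) hw].
set B := [set x | _]; rewrite ler_pdivlMr //.
rewrite -(ler_pM2r (bound_gt0 u D)) -mulrA -(bound_adjacent vD uv).
apply: (@le_trans _ _ (N * (weight u D phi)%:R)); last by rewrite ler_pM2l.
rewrite -(weight_adjacent _ vD uv) natr_card mulr_suml; apply: ler_sum => x _; rewrite inE.
by case: ltP => [/ltW|_]; rewrite ?mul1r ?mul0r.
Qed.

(** * The greedy step and its iteration *)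

Lemma invariant_step D phi : invariant D phi -> D != setT ->
  exists v x, v \notin D /\ invariant (v |: D) (upd phi v x).
Proof.
move=> inv DT; have [hD hi hF hw] := inv.
have [v0 v0D] : exists v, v \in ~: D.
  by apply/set0Pn; apply: contraNneq DT => h; rewrite -[D]setCK h setC0.
case: (arg_minnP (P := mem (~: D)) (fun v => p v : nat) v0D) => v; rewrite /= inE => vD vm.
have vmin v' : (p v' < p v)%N -> v' \in D.
  by apply: contraLR => v'D; rewrite -leqNgt; apply: vm; rewrite inE.
set C := [set x | [forall e in link v, upd (edge_image phi e) (p v) x \in H (p v).+1]].
have hC : delta * N <= #|C|%:R := candidates inv vD vmin.
pose B u := [set x | bound u (v |: D) < (weight u (v |: D) (upd phi v x))%:R].
pose A := [set u | adjacent v u] :\: D.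
(* Used vertices take at most half of the guaranteed [delta * N] candidates. Those overloading an
   unembedded neighbour of [v] take less than half, by the choice of [gamma]. *)
case: (pickP [pred x | (x \in C) && (x \notin phi @: D) && [forall u in A, x \notin B u]])
  => [x /= /andP[/andP[xC xD] /forall_inP xB]|none]; last first.
  exfalso.
  have CS : C \subset (phi @: D) :|: \bigcup_(u in A) B u.
    apply/subsetP => x xC; have /= := none x; rewrite xC inE /=.
    case: (x \in phi @: D) => //= /negbT; rewrite negb_forall_in => /exists_inP[u uA].
    by rewrite negbK => xu; apply/bigcupP; exists u.
  have : #|C|%:R <= #|V|%:R + #|A|%:R * (N / gamma).
    apply: (@le_trans _ _ (#|phi @: D| + \sum_(u in A) #|B u|)%N%:R).
      rewrite ler_nat (leq_trans (subset_leq_card CS)) //.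
      apply: leq_trans (leq_card_setU _ _).1 _; rewrite leq_add2l.
      elim/big_ind2: _ => // [|m1 m2 m3 m4 h1 h2]; first by rewrite cards0.
      by apply: leq_trans (leq_card_setU _ _).1 _; apply: leq_add.
    rewrite natrD; apply: lerD.
      by rewrite ler_nat (leq_trans (leq_imset_card _ _)) ?max_card.
    rewrite natr_sum mulr_natl -sumr_const; apply: ler_sum => u.
    rewrite !inE adjacent_sym => /andP[uD uv].
    exact: card_overweight.
  have hA : #|A|%:R <= (d * l)%:R :> R.
    rewrite ler_nat; apply: leq_trans (card_adjacent v).
    by apply: subset_leq_card; apply: subsetDl.
  have -> : N / gamma = delta * N / (2 * (d * l).+1%:R).
    by rewrite /gamma invf_div mulrCA mulrA.
  have dl0 : 0 < (d * l).+1%:R :> R by rewrite ltr0n.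
  have h : #|A|%:R * (delta * N / (2 * (d * l).+1%:R)) < delta * N / 2.
    rewrite mulrA ltr_pdivrMr ?mulr_gt0 //.
    have -> : delta * N / 2 * (2 * (d * l).+1%:R) = (d * l).+1%:R * (delta * N) by field.
    rewrite ltr_pM2r ?mulr_gt0 //; apply: le_lt_trans hA _.
    by rewrite ltr_nat.
  move: h hC U_large; set q := _ * (_ / _); set r := delta * N; clearbody q r.
  by lra.
exists v, x; split=> //; split.
- move=> w w'; rewrite !inE => /orP[/eqP -> /vmin ->|wD /(hD _ _ wD) ->];
    by rewrite orbT.
- have new w : w \in D -> phi w != x.
    by move=> wD; apply: contraNneq xD => <-; apply: imset_f.
  move=> w w'; rewrite !inE !ffunE.
  case: eqP => [->|_] /=; case: eqP => [->|_] //=; last exact: hi.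
  + by move=> _ w'D _ xw; have := new _ w'D; rewrite -xw eqxx.
  + by move=> wD _ _ xw; have := new _ wD; rewrite xw eqxx.
- move=> e eF k kl he.
  have updE : edge_image (upd phi v x) e =1 
     (if e (p v) == v then upd (edge_image phi e) (p v) x else edge_image phi e).
    move=> i; case: ifP => ev; rewrite !ffunE.
      have [->|iv] := eqVneq i (p v); first by rewrite ev.
      by case: eqP => // h; move: iv; rewrite -h F_part ?eqxx.
    case: eqP => // h; move: ev; rewrite -h F_part // eqxx //.
  have heD (i : 'I_l) : (i < k)%N -> i != p v -> e i \in D.
    move=> ik iv; have := he i ik; rewrite !inE => /orP[/eqP h|//].
    by move: iv; rewrite -h F_part ?eqxx.
  (* For [k <= p v] the new value is not read. For [k] above [(p v).+1], [e] would have a vertex of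
     [D] in the part after that of [v], forcing [v] into [D]. At equality, either [e] contains [v]
     and [x] is a candidate for it, or its first [k] vertices were already in [D]. *)
  case: (ltngtP k (p v).+1) => [kv|kv|kv].
  + rewrite (@H_lower k kl _ (edge_image phi e)).
      by apply: hF => // i ik; apply: heD => //; apply: contraTneq ik => ->; rewrite -leqNgt.
    move=> i ik; rewrite updE; case: ifP => // _; rewrite ffunE.
    by case: eqP => // iv; move: ik; rewrite iv ltnNge -ltnS kv.
  + have jl : ((p v).+1 < l)%N by apply: leq_trans kl.
    have := @heD (Ordinal jl) kv; rewrite -val_eqE /= gtn_eqF // => /(_ isT) jD.
    by move: vD; rewrite (hD _ v jD) // F_part /=.
  + case ev: (e (p v) == v); last first.
      rewrite (@H_lower k kl _ (edge_image phi e)) => [|i ik]; last by rewrite updE ev.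
      apply: hF => // i ik; apply: contraFT ev => eiD.
      have := he i ik; rewrite !inE (negbTE eiD) orbF => /eqP h.
      by rewrite -h F_part // h.
    rewrite (@H_lower k kl _ (upd (edge_image phi e) (p v) x)) => [|i ik]; last first.
      by rewrite updE ev.
    by move: xC; rewrite inE => /forall_inP/(_ e); rewrite inE eF ev -kv; apply.
- move=> u; rewrite !inE negb_or => /andP[uv uD].
  have [uadj|unadj] := boolP (adjacent u v).
    have := xB u; rewrite !inE adjacent_sym uadj uD -leNgt; exact.
  by rewrite weight_nonadjacent // bound_nonadjacent // hw.
Qed.

Theorem embedding : exists phi : {ffun V -> U},
  (forall v v', p v = p v' -> phi v = phi v' -> v = v') /\
  forall e, e \in F -> edge_image phi e \in H l.
Proof.
have /card_gt0P[x0 _] := U_gt0.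
suff ind m D phi : invariant D phi -> (#|~: D| <= m)%N ->
    exists psi, invariant setT psi.
  (* Start from the empty [D]; the constant [x0] is a placeholder. *)
  have [||psi [_ hi hF _]] := ind #|V| set0 [ffun=> x0]; last 1 first.
  - exists psi; split=> [v v'|e eF]; first by apply: hi; rewrite inE.
    by apply: hF => // i _; rewrite inE.
  - split=> [v v'|v v'|e eF k kl he|u _]; rewrite ?inE //.
      case: k kl he => [_ _|k kl he]; first by rewrite H0 inE.
      by have := he (Ordinal (leq_trans (ltn0Sn k) kl)) isT; rewrite inE.
    have -> : weight u set0 [ffun=> x0] = #|bad d (delta * N) (p u) (H (p u)) (H (p u).+1)|.
      by apply: eq_card => Y; rewrite inE overwrite0.
    apply: le_trans (H_bad _) _; rewrite /bound.
    rewrite ler_pM2r ?exprn_gt0 // -[leLHS]mulr1 ler_pM2l //.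
    by rewrite exprn_ege1.
  - exact: max_card.
elim: m D phi => [|m IH] D phi inv hD.
  exists phi; move: hD; rewrite leqn0 cards_eq0 => /eqP h.
  by rewrite -setC0 -h setCK.
have [DT|DT] := eqVneq D setT; first by exists phi; rewrite -DT.
have [v [x [vD inv']]] := invariant_step inv DT.
apply: IH inv' _; rewrite -ltnS; apply: leq_trans hD.
apply: proper_card; rewrite properC; apply/properP.
split; first exact: subsetUr.
by exists v; rewrite ?setU11.
Qed.

End Embedding.

(** * Choice of the constants *)

(* t = tau l * Delta, split as follows: 2 l pays for delta^(Delta l) in
   gamma^(Delta l), 3 for the 2^(Delta^l) choices of a set of selections, and
   4 l^2 for the numerator of gamma^(Delta l). *)
Definition tau (l : nat) : nat := (2 * l + 3 + 4 * l ^ 2)%N.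

Lemma tau_gt0 l : (0 < tau l)%N.
Proof. by rewrite /tau addn_gt0 addnS. Qed.

(** With [d ^ l.-1] factored out: twice the exponent of the smallest sliced density, as [delta] is
    its square, plus 1 to pay for the 2 in [2 * #|V|%:R <= delta * N]. *)
Definition expo (l : nat) : nat := ((2 * (2 * tau l) ^ l.-1).+1)%N.

(** With [M = d ^ l.-1], the term [3 * d] covers the first factor because [d ^ l = M * d]. The other
    term covers the second, as [2 * (d * l).+1 <= 4 * l * M < 2 ^ (4 * l * M)] when [d <= M]. *)
Lemma exponent_ineq (l d : nat) : (0 < l)%N -> (0 < d)%N -> (d <= d ^ l.-1)%N ->
  (2 ^ (d ^ l).+1 * (2 * (d * l).+1) ^ (d * l)
    < 2 ^ (d ^ l.-1 * (3 * d + 4 * l ^ 2 * d)))%N.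
Proof.
move=> l0 d0; set M := (d ^ l.-1)%N => dM.
have M0 : (0 < M)%N by rewrite expn_gt0 d0.
rewrite mulnDr expnD; apply: (@leq_trans (2 ^ (M * (3 * d)) * (2 * (d * l).+1) ^ (d * l))%N).
  rewrite ltn_pmul2r ?expn_gt0 ?muln_gt0 // ltn_exp2l //.
  rewrite -(prednK l0) expnSr -/M mulnCA.
  rewrite (@leq_ltn_trans (2 * (M * d))) // ?ltn_pmul2r ?muln_gt0 ?M0 ?d0 //.
  by rewrite mul2n -addnn -addn1 leq_add2l muln_gt0 M0.
rewrite leq_pmul2l ?expn_gt0 //.
have -> : (M * (4 * l ^ 2 * d) = (4 * l * M) * (d * l))%N by rewrite expnS expn1; lia.
rewrite [leqRHS]expnM leq_exp2r ?muln_gt0 ?d0 //.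
apply: leq_trans (ltnW (ltn_expl _ (ltnSn 1))).
have := leq_mul dM (leqnn l); lia.
Qed.

Theorem partite_embedding (R : realFieldType) (U V : finType) (l d : nat)
    (p : V -> 'I_l) (F : {set {ffun 'I_l -> V}}) (K : {set {ffun 'I_l -> U}}) (a : R) :
  (0 < l)%N -> (0 < d)%N -> (d <= d ^ l.-1)%N ->
  (forall e, e \in F -> forall i, p (e i) = i) ->
  (forall v, (#|link p F v| <= d)%N) ->
  0 < a -> a <= 2^-1 -> (0 < #|U|)%N ->
  2 * a * #|U|%:R ^+ l <= #|K|%:R ->
  #|V|%:R <= a ^+ (expo l * d ^ l.-1) * #|U|%:R ->
  exists phi : V -> U,
    (forall v v', p v = p v' -> phi v = phi v' -> v = v') /\
    forall e, e \in F -> [ffun i => phi (e i)] \in K.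
Proof.
move=> l0; case: d => // d' d0 dM hp hdeg a0 a2 U0 hK hV; set d := d'.+1 in d0 dM hdeg hV.
set M := (d ^ l.-1)%N in dM hV.
have M0 : (0 < M)%N by rewrite expn_gt0 d0.
(* [eta] bounds from below every density that gets sliced; [beta] turns the last hypothesis of
   [exists_chain] into an equality. *)
pose t := (tau l * d)%N; pose eta := a ^+ ((2 * t) ^ l.-1); pose delta := eta ^+ 2.
pose beta : R := 2 ^+ (d ^ l).+1 * eta ^+ t.
have a1 : a <= 1 by apply: le_trans a2 _; rewrite invf_le1 ?ler1n.
have eta0 : 0 < eta by apply: exprn_gt0.
have delta0 : 0 < delta by apply: exprn_gt0.
have beta0 : 0 < beta by rewrite mulr_gt0 ?exprn_gt0.
have eta1 : eta <= 1 by rewrite exprn_ile1 ?(ltW a0).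
have delta1 : delta <= 1 by rewrite exprn_ile1 ?(ltW eta0).
have etaE : ((2 * t) ^ l.-1 = (2 * tau l) ^ l.-1 * M)%N by rewrite /t mulnA expnMn.
have etaM : eta * 2 ^+ M <= 1.
  apply: (@le_trans _ _ ((a * 2) ^+ M)); last first.
    by apply: exprn_ile1; lra.
  rewrite exprMn ler_wpM2r ?exprn_ge0 //; apply: ler_wiXn2l => //; first exact: ltW.
  by rewrite etaE leq_pmull // expn_gt0 muln_gt0 tau_gt0.
have t0 : (0 < t)%N by rewrite muln_gt0 d0 tau_gt0.
have [|H [Hl H0 Hlow Hbad]] := @exists_chain R U l d t U0 a beta delta K
    a0 a2 t0 delta0 (ltW beta0) hK.
  by rewrite -/eta /beta /delta exprAC expr2 natrX exprS !mulrA.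
have [||phi [hi hF]] := @embedding R U V l d' p F hp hdeg H beta delta H0 Hlow
  beta0 delta0 delta1 Hbad _ _ U0; last first.
- by exists phi; split=> // e eF; rewrite -Hl; apply: hF.
- apply: le_trans (ler_wpM2l (ler0n _ 2) hV) _.
  rewrite mulrA ler_wpM2r // /delta /eta -exprM etaE.
  rewrite /expo mulSn exprD mulrA -(mulnA 2%N) [(_ * M * 2)%N]mulnC.
  rewrite -[leRHS]mul1r ler_wpM2r ?exprn_ge0 ?(ltW a0) //.
  apply: (@le_trans _ _ (2 * a)); last lra.
  by rewrite ler_pM2l // -[leRHS]expr1; apply: ler_wiXn2l => //; apply: ltW.
- have := @exponent_ineq l d l0 d0 dM; rewrite -/M.
  set q := (3 * _ + _)%N; set c := (2 * _)%N; set m := (d * l)%N => hq.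
  (* [eta ^+ (2 * m)] is [delta ^+ m] and cancels the denominator of [gamma ^+ m]; the remaining
     [eta ^+ q] beats the integer factor because [eta * 2 ^+ M <= 1]. *)
  have tq : t = (2 * m + q)%N by rewrite /t /tau /q /m; lia.
  have -> : beta * (2 * (m.+1)%:R / delta) ^+ m = (2 ^ (d ^ l).+1 * c ^ m)%:R * eta ^+ q.
    rewrite /beta tq exprD exprM -/delta natrM !natrX /c natrM expr_div_n.
    by field; rewrite expf_neq0 // gt_eqF.
  apply: (@lt_le_trans _ _ ((2 ^ (M * q))%:R * eta ^+ q)).
    by rewrite ltr_pM2r ?exprn_gt0 // ltr_nat.
  rewrite natrX exprM -exprMn exprn_ile1 1?mulrC //.
  by rewrite mulr_ge0 ?exprn_ge0 ?ltW.
Qed.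

(** * From hypergraphs to functions *)

Lemma edge_transversal (l : nat) (V : finType) (H : hypergraph V)
    (P : 'I_l -> {set V}) e : partite_by H P -> e \in H ->
  exists2 g : {ffun 'I_l -> V}, forall i, g i \in P i & g @: [set: 'I_l] = e.
Proof.
move=> [cover _ one] eH.
have /fin_all_exists[g hg] : forall i, exists x, x \in e :&: P i.
  by move=> i; apply/card_gt0P; rewrite one.
exists (finfun g) => [i|]; first by have := hg i; rewrite ffunE inE => /andP[].
apply/setP => x; apply/imsetP/idP => [[i _ ->]|xe].
  by have := hg i; rewrite ffunE inE => /andP[].
have : x \in \bigcup_i P i by rewrite cover inE.
move=> /bigcupP[i _ xi]; exists i; rewrite ?inE // ffunE.
have /eqP/cards1P[y hy] := one e eH i.
have := hg i; rewrite hy inE => /eqP ->.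
have : x \in e :&: P i by rewrite inE xe.
by rewrite hy inE => /eqP.
Qed.

(** Number each part by ['I_N]; every edge is then the image of the point listing its vertices. *)
Lemma host_model (l N : nat) (W : finType) (G : hypergraph W)
    (P : 'I_l -> {set W}) : partite_by G P -> (forall i, #|P i| = N) ->
  exists w : 'I_l -> 'I_N -> W, [/\ forall i, injective (w i),
    forall i x, w i x \in P i &
    (#|G| <= #|[set g : {ffun 'I_l -> 'I_N} |
                 [set w i (g i) | i in [set: 'I_l]] \in G]|)%N].
Proof.
move=> hG hN; pose w i x := enum_val (cast_ord (esym (hN i)) x).
exists w; split=> [i x y /enum_val_inj/cast_ord_inj //|i x|]; first exact: enum_valP.
set K := [set g | _]; pose img (g : {ffun 'I_l -> 'I_N}) := [set w i (g i) | i in [set: 'I_l]].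
apply: leq_trans (leq_imset_card img K); apply: subset_leq_card.
apply/subsetP => e eG; have [g gP ge] := edge_transversal hG eG.
pose h := [ffun i => cast_ord (hN i) (enum_rank_in (gP i) (g i))].
have he : img h = e.
  rewrite -ge; apply: eq_imset => i.
  by rewrite /w ffunE cast_ordK enum_rankK_in.
by apply/imsetP; exists h => //; rewrite inE -/(img h) he.
Qed.

(** [E] lists each edge part by part; the list is determined by the edge, so degrees do not grow. *)
Lemma guest_model (l : nat) (V : finType) (F : hypergraph V) : partite l F ->
  exists (p : V -> 'I_l) (E : {set {ffun 'I_l -> V}}), [/\
    forall e, e \in E -> forall i, p (e i) = i,
    forall e, e \in F -> exists2 g, g \in E & g @: [set: 'I_l] = e &
    forall v, (#|link p E v| <= max_degree F)%N].
Proof.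
move=> [P hF]; have [cover disj _] := hF.
have /fin_all_exists[p hp] : forall v, exists i, v \in P i.
  move=> v; have : v \in \bigcup_i P i by rewrite cover inE.
  by case/bigcupP => i _ vi; exists i.
have pP v i : v \in P i -> p v = i.
  move=> vi; apply/eqP; apply: contraTT isT => /disj; rewrite disjoint_subset.
  by move=> /subsetP/(_ v (hp v)); rewrite inE vi.
pose E := [set g : {ffun 'I_l -> V} | (g @: [set: 'I_l] \in F) && [forall i, p (g i) == i]].
have Ep e : e \in E -> forall i, p (e i) = i.
  by rewrite inE => /andP[_ /forallP h] i; apply/eqP.
exists p, E; split=> // [e eF|v].
  have [g gP ge] := edge_transversal hF eF; exists g => //.
  by rewrite inE ge eF; apply/forallP => i; rewrite (pP _ i) //.
apply: leq_trans (leq_bigmax v).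
rewrite /degree -(card_in_imset (f := fun e : {ffun 'I_l -> V} => e @: [set: 'I_l])).
  apply: subset_leq_card; apply/subsetP => _ /imsetP[e + ->].
  rewrite !inE => /andP[/andP[-> _] /eqP <-]; exact: imset_f.
move=> e f; rewrite !inE -!andbA => /and3P[_ /forallP he _] /and3P[_ /forallP hf _] ef.
apply/ffunP => i; have : e i \in f @: setT by rewrite -ef imset_f.
case/imsetP => j _ eij; rewrite eij; congr (f _).
by rewrite -(eqP (hf j)) -eij (eqP (he i)).
Qed.

(** Provides [Delta <= Delta ^ l.-1] when [l] is 1: the only possible edge through [v] is its
    singleton. *)
Lemma max_degree_uniform1 (V : finType) (F : hypergraph V) :
  uniform 1 F -> (max_degree F <= 1)%N.
Proof.
move=> hF; apply/bigmax_leqP => v _; rewrite -(cards1 [set v]).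
apply: subset_leq_card; apply/subsetP => e; rewrite !inE => /andP[/hF/eqP/cards1P[x ->]].
by rewrite inE => /eqP ->.
Qed.

Lemma max_degree_gt0 (V : finType) (F : hypergraph V) e v :
  e \in F -> v \in e -> (0 < max_degree F)%N.
Proof.
move=> eF ve; apply: leq_trans (leq_bigmax v).
by apply/card_gt0P; exists e; rewrite inE eF.
Qed.

Lemma contains_copy_of_inj (V W : finType) (F : hypergraph V) (G : hypergraph W)
    (f : V -> W) : injective f -> (forall e, e \in F -> f @: e \in G) ->
  contains_copy F G.
Proof.
move=> finj fF; exists (f @: [set: V]), [set f @: e | e : {set V} in F].
split; last by exists f.
split; first by apply/subsetP => _ /imsetP[e eF ->]; apply: fF.
by move=> _ /imsetP[e _ ->]; apply: imsetS; apply: subsetT.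
Qed.

(** Zero parts cover no vertex of [F], and all edges on both sides are empty. *)
Lemma contains_copy0 (V W : finType) (F : hypergraph V) (G : hypergraph W) :
  uniform 0 F -> partite 0 F -> uniform 0 G -> (0 < #|G|)%N -> contains_copy F G.
Proof.
move=> uF [P [cover _ _]] uG /card_gt0P[e0 e0G].
have noV (v : V) : False.
  have : v \in \bigcup_i P i by rewrite cover inE.
  by case/bigcupP => -[].
apply: (@contains_copy_of_inj _ _ _ _ (fun v => False_rect W (noV v)))
  => [v|e /uF/cards0_eq ->].
  by case: (noV v).
by rewrite imset0; have /cards0_eq <- := uG _ e0G.
Qed.

(** * Degenerate cases and reduction to the embedding of functions *)

Theorem theorem2 (R : realType) (l : nat) :
  exists c : R,
    forall (V : finType) (F : hypergraph V) (n Delta : nat),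
      uniform l F -> partite l F -> #|V| = n -> max_degree F = Delta ->
    forall (eps : R), 0 < eps ->
    forall (W : finType) (G : hypergraph W) (N : nat),
      uniform l G ->
      (exists P : 'I_l -> {set W}, partite_by G P /\ forall i, #|P i| = N) ->
      (eps / 2) `^ (- c * Delta%:R ^+ l.-1) * n%:R <= N%:R ->
      eps * N%:R ^+ l <= #|G|%:R ->
      contains_copy F G.
Proof.
exists (expo l)%:R => V F n Delta uF pF Vn FD eps eps0 W G N uG [P [pG PN]] hN hG.
have [l0|l0] := posnP l.
  subst l; apply: contains_copy0 => //; move: hG; rewrite expr0 mulr1 -(ltr0n R).
  exact: lt_le_trans.
set a := eps / 2 in hN; have a0 : 0 < a by rewrite divr_gt0.
have [w [winj wP Gw]] := host_model pG PN; set K := [set g | _] in Gw.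
have powE : a `^ (- (expo l)%:R * Delta%:R ^+ l.-1) = (a ^+ (expo l * Delta ^ l.-1))^-1.
  by rewrite mulNr powRN -natrX -natrM powR_mulrn // ltW.
rewrite {}powE mulrC ler_pdivrMr ?exprn_gt0 // mulrC in hN.
have [n0|n0] := posnP n.
  have V0 (v : V) : False by have := fintype0 v; rewrite Vn; apply.
  apply: (@contains_copy_of_inj _ _ _ _ (fun v => False_rect W (V0 v))) => [v|e eF].
    by case: (V0 v).
  have := uF e eF; have -> : e = set0 by apply/setP => v; case: (V0 v).
  by rewrite cards0 => h; rewrite -h in l0.
have N0 : (0 < N)%N.
  rewrite lt0n; apply: contraTneq hN => ->; rewrite mulr0 -ltNge.
  by rewrite ltr0n.
(* [G] has at most [N ^ l] edges, so [eps] is at most 1. *)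
have a2 : a <= 2^-1.
  rewrite ler_pdivrMr // mulVf ?pnatr_eq0 //.
  rewrite -(ler_pM2r (exprn_gt0 l _ : 0 < N%:R ^+ l)) ?ltr0n // mul1r.
  apply: le_trans hG _; rewrite -natrX ler_nat; apply: leq_trans Gw _.
  by apply: leq_trans (max_card _) _; rewrite card_ffun !card_ord.
(* An edgeless [F] fits inside one part; otherwise an edge gives [0 < Delta]. *)
have [F0|[e0 e0F]] := set_0Vmem F.
  have nN : (n <= N)%N.
    rewrite -(ler_nat R); apply: le_trans hN _.
    rewrite ler_piMl // exprn_ile1 ?ltW //; lra.
  pose i0 := Ordinal l0.
  apply: (@contains_copy_of_inj _ _ _ _
    (fun v => w i0 (widen_ord nN (cast_ord Vn (enum_rank v))))) => [v v'|e].
    by move=> /winj /(congr1 val) /= /val_inj/enum_rank_inj.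
  by rewrite F0 inE.
have [v0 v0e] : exists v, v \in e0 by apply/card_gt0P; rewrite uF.
have D0 : (0 < Delta)%N by rewrite -FD; apply: max_degree_gt0 v0e.
have DM : (Delta <= Delta ^ l.-1)%N.
  have [l1|l1] := ltnP 1 l; first by rewrite -[leqLHS]expn1 leq_pexp2l // -ltnS prednK.
  have l1E : l = 1%N by apply/eqP; rewrite eqn_leq l1.
  by rewrite l1E expn0 -FD; apply: max_degree_uniform1; rewrite -l1E.
have [p [E [Ep FE]]] := guest_model pF; rewrite FD => Edeg.
have [|||phi [hi hE]] := @partite_embedding R 'I_N V l Delta p E K a l0 D0 DM Ep Edeg a0 a2.
- by rewrite card_ord.
- rewrite card_ord [2 * a]mulrC /a divfK ?pnatr_eq0 //; apply: le_trans hG _.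
  by rewrite ler_nat.
- by rewrite card_ord Vn.
have [_ disj _] := pG.
(* [phi] is injective only within each part; the parts of [G] being disjoint gives injectivity
   overall. *)
apply: (@contains_copy_of_inj _ _ _ _ (fun v => w (p v) (phi v))) => [v v' vv|e eF].
  have pv : p v = p v'.
    apply/eqP; apply: contraTT isT => /disj; rewrite disjoint_subset.
    move=> /subsetP/(_ (w (p v) (phi v)) (wP _ _)); rewrite vv inE.
    by rewrite wP.
  by apply: hi => //; move: vv; rewrite pv => /winj.
have [g gE <-] := FE e eF; have := hE g gE; rewrite inE; congr (_ \in G).
rewrite -imset_comp; apply: eq_imset => i /=.
by rewrite ffunE Ep.
Qed.
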